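(* Let $P$ be a Dedekind Poisson algebra over an arbitrary field $F$, with idempotent--nil decomposition $P(+,\cdot)=E\oplus N$ (described in the context). If $N^2=Fc\neq0$ for some $c\in N$, then $$\operatorname{Ann}(N)\subseteq\zeta(P(+,[\,,\,])).$$
   Context: A Poisson algebra over a field $F$ is an $F$-vector space $P$ with a bilinear commutative associative multiplication $xy$ (no identity element is assumed) and an alternating Lie bracket $[\,,\,]$ ($[x,x]=0$ for all $x$) satisfying $[xy,z]=x[y,z]+y[x,z]$. A Poisson subalgebra is a subspace closed under both operations; a Poisson ideal is a subspace $I$ with $PI\subseteq I$ and $[P,I]\subseteq I$. A Poisson algebra is Dedekind if every Poisson subalgebra is a Poisson ideal. No finite-dimensionality is assumed. Idempotent--nil decomposition of a Dedekind Poisson algebra $P$: the associative algebra $P(+,\cdot)$ has at most one non-zero idempotent. If it has none, $E=0$ and $N=P$; if $e$ is the non-zero idempotent, $E=Fe$ and $N=\{x\in P: ex=0\}$. One has $P(+,\cdot)=E\oplus N$ as a direct sum of associative ideals, $EN=0$, $N^3=0$, $\dim_FN^2\le1$. Here $N^2$ is the linear span of products of two elements of $N$, $N^3=N^2N$, $\operatorname{Ann}(N)=\{a\in N\mid aN=0\}$, and $\zeta(P(+,[\,,\,]))=\{z\in P\mid [z,P]=0\}$ is the center of the Lie algebra $P(+,[\,,\,])$. *)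

(* Defs.v *)
From HB Require Import structures.
From mathcomp Require Import all_boot all_order all_algebra.
From mathcomp Require Import classical_sets.

Set Implicit Arguments.
Unset Strict Implicit.
Unset Printing Implicit Defensive.

Import GRing.Theory.
Local Open Scope classical_set_scope.
Local Open Scope ring_scope.

(* The associative product is not required to have an identity element, so it
   cannot be given by MathComp's ring or algebra structures. *)
HB.mixin Record isPoissonAlgebra (F : fieldType) P of GRing.Lmodule F P := {
  pmul : P -> P -> P;
  pbracket : P -> P -> P;
  pmul_bilinear : bilinear_for *:%R *:%R pmul;
  pmulC : commutative pmul;
  pmulA : associative pmul;
  pbracket_bilinear : bilinear_for *:%R *:%R pbracket;
  pbracket_alternating : forall x, pbracket x x = 0;
  pbracket_jacobi : forall x y z,
    pbracket x (pbracket y z) + pbracket y (pbracket z x)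
      + pbracket z (pbracket x y) = 0;
  pbracket_leibniz : forall x y z,
    pbracket (pmul x y) z = pmul x (pbracket y z) + pmul y (pbracket x z)
}.

#[short(type="poissonAlgType")]
HB.structure Definition PoissonAlgebra (F : fieldType) :=
  {P of isPoissonAlgebra F P & GRing.Lmodule F P}.

Notation "x ** y" := (pmul x y) (at level 40, left associativity) : ring_scope.
Notation "\[ x , y ]" := (pbracket x y)
  (at level 0, x at level 99, y at level 99, format "\[ x ,  y ]") : ring_scope.

Section LinearAlgebra.
Variables (F : fieldType) (V : lmodType F).

Definition subspace (A : set V) : Prop := submod_closed (mem A).

Definition line (v : V) : set V := range (fun a : F => a *: v).

Definition lin_span (A : set V) : set V :=
  [set v | exists (n : nat) (a : 'I_n -> F) (s : 'I_n -> V),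
     (forall i, A (s i)) /\ v = \sum_(i < n) a i *: s i].

End LinearAlgebra.

Section PoissonAlgebraTheory.
Variables (F : fieldType) (P : poissonAlgType F).
Implicit Types A E I N S : set P.

Definition poisson_subalgebra S : Prop :=
  [/\ subspace S,
      forall x y, S x -> S y -> S (x ** y) &
      forall x y, S x -> S y -> S \[x, y]].

Definition poisson_ideal I : Prop :=
  [/\ subspace I,
      forall x y, I y -> I (x ** y) &
      forall x y, I y -> I \[x, y]].

Definition dedekind : Prop :=
  forall S, poisson_subalgebra S -> poisson_ideal S.

Definition idempotent (e : P) : Prop := e ** e = e.

(* A Dedekind Poisson algebra has at most one non-zero idempotent, so that this
   relation then determines E and N. *)
Definition idempotent_nil_decomposition E N : Prop :=
  [/\ forall e, idempotent e -> e = 0, E = [set 0] & N = setT]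
  \/ exists e, [/\ e != 0, idempotent e, E = line e & N = [set x | e ** x = 0]].

Definition prod_space A B : set P := lin_span [set x ** y | x in A & y in B].

Definition annihilator N : set P :=
  [set a | N a /\ forall x, N x -> a ** x = 0].

End PoissonAlgebraTheory.

Arguments dedekind {F} P.

Definition lie_center (F : fieldType) (P : poissonAlgType F) : set P :=
  [set z | forall x, \[z, x] = 0].
Arguments lie_center {F} P.

(* Main.v *)
Require Import Defs.
From mathcomp Require Import all_boot all_order all_algebra.
From mathcomp Require Import classical_sets.
Import GRing.Theory.
Local Open Scope classical_set_scope.
Local Open Scope ring_scope.

(** In a Dedekind Poisson algebra every element of square zero is central for
    the bracket, and the elements of [annihilator N] have square zero because
    they lie in [N] and kill it.

    Two subalgebras, hence ideals, force this. If [a ** a = 0], the line spanned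
    by [a] is a subalgebra, so [\[a, x] = k *: a] for some scalar [k]. By the
    Jacobi and Leibniz identities the centralizer of [x] is a subalgebra too; it
    contains [x], so being an ideal it contains [\[a, x]]. Hence
    [0 = \[\[a, x], x] = k *: \[a, x]], and either [k = 0] or [\[a, x] = 0]; in
    both cases [\[a, x] = 0]. *)

Section Bracket.
Variables (F : fieldType) (P : poissonAlgType F).
Implicit Types (a x y z : P) (k : F).

Lemma pbracketZDl k x y z : \[k *: x + y, z] = k *: \[x, z] + \[y, z].
Proof. exact: (pbracket_bilinear (s := P)).1. Qed.

Lemma pbracketZDr k x y z : \[x, k *: y + z] = k *: \[x, y] + \[x, z].
Proof. exact: (pbracket_bilinear (s := P)).2. Qed.

Lemma pmulZDl k x y z : (k *: x + y) ** z = k *: (x ** z) + y ** z.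
Proof. exact: (pmul_bilinear (s := P)).1. Qed.

Lemma pbracket0l x : \[0, x] = 0.
Proof. by have := pbracketZDl (-1) 0 0 x; rewrite !scaleN1r oppr0 addr0 addNr. Qed.

Lemma pbracket0r x : \[x, 0] = 0.
Proof. by have := pbracketZDr (-1) x 0 0; rewrite !scaleN1r oppr0 addr0 addNr. Qed.

Lemma pmul0l x : 0 ** x = 0 :> P.
Proof. by have := pmulZDl (-1) 0 0 x; rewrite !scaleN1r oppr0 addr0 addNr. Qed.

Lemma pbracketZl k x z : \[k *: x, z] = k *: \[x, z].
Proof. by have := pbracketZDl k x 0 z; rewrite pbracket0l !addr0. Qed.

Lemma pbracketZr k x z : \[z, k *: x] = k *: \[z, x].
Proof. by have := pbracketZDr k z x 0; rewrite pbracket0r !addr0. Qed.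

Lemma pmulZl k x z : (k *: x) ** z = k *: (x ** z).
Proof. by have := pmulZDl k x 0 z; rewrite pmul0l !addr0. Qed.

Lemma pbracketC x y : \[x, y] = - \[y, x].
Proof.
have := pbracket_alternating (1 *: x + y).
rewrite pbracketZDl !pbracketZDr !pbracket_alternating !scale1r add0r addr0.
by move/eqP; rewrite addr_eq0 => /eqP.
Qed.

Lemma line_subalgebra a : a ** a = 0 -> poisson_subalgebra (line a).
Proof.
move=> aa; split.
- split; first by rewrite inE; exists 0; rewrite ?scale0r.
  move=> k x y; rewrite !inE => -[l _ <-] [m _ <-].
  by exists (k * l + m); rewrite // scalerDl scalerA.
- move=> x y [l _ <-] [m _ <-]; exists 0; rewrite // scale0r.
  by rewrite pmulZl pmulC pmulZl aa !scaler0.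
- move=> x y [l _ <-] [m _ <-]; exists 0; rewrite // scale0r.
  by rewrite pbracketZl pbracketZr pbracket_alternating !scaler0.
Qed.

(** The Leibniz rule gives closure under the product and the Jacobi identity
    closure under the bracket. *)
Lemma centralizer_subalgebra x : poisson_subalgebra [set y | \[y, x] = 0].
Proof.
split.
- split; first by rewrite inE /= pbracket0l.
  by move=> k y z; rewrite !inE /= pbracketZDl => -> ->; rewrite scaler0 addr0.
- move=> y z /= yx zx; rewrite pbracket_leibniz yx zx.
  by rewrite ![_ ** 0]pmulC !pmul0l addr0.
- move=> y z /= yx zx; have := pbracket_jacobi y z x.
  rewrite zx (pbracketC x y) yx oppr0 !pbracket0r !add0r.
  by rewrite (pbracketC x) => /eqP; rewrite oppr_eq0 => /eqP.
Qed.

(** The ideal spanned by [a] makes [a] an eigenvector of the bracket with [x];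
    the ideal centralizing [x] makes that bracket nilpotent on [a]. *)
Lemma dedekind_sqr0_central a : dedekind P -> a ** a = 0 -> lie_center P a.
Proof.
move=> dedP aa x.
have [_ _ line_ideal] := dedP _ (line_subalgebra a aa).
have [_ _ cent_ideal] := dedP _ (centralizer_subalgebra x).
have [k _ ka] : line a \[x, a].
  by apply: line_ideal; exists 1; rewrite ?scale1r.
have ax : \[a, x] = (- k) *: a by rewrite pbracketC -ka scaleNr.
(* The centralizer of [x] contains [x], hence every bracket with [x]. *)
have : \[\[a, x], x] = 0 by apply: cent_ideal; apply: pbracket_alternating.
rewrite {1}ax pbracketZl => /eqP; rewrite scaler_eq0 => /orP[/eqP k0|/eqP //].
by rewrite ax k0 scale0r.
Qed.

End Bracket.

Theorem lemma5p5 (F : fieldType) (P : poissonAlgType F) (E N : set P) (c : P)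
    (hP : dedekind P) (hEN : idempotent_nil_decomposition E N)
    (hc : N c) (hN2 : prod_space N N = line c) (hN2_neq0 : prod_space N N <> [set 0]) :
  annihilator N `<=` lie_center P.
Proof. by move=> a [Na aN]; apply: dedekind_sqr0_central => //; apply: aN. Qed.
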